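(* The inequalities $$\sum_{j\in N_\alpha} y_j+\sum_{j\in N\setminus\bigcup_{j'\in N_\alpha}(S_{ij'}\cup\{i,j'\})} x_{ij}\le \alpha \quad \forall i\in N,\ \forall N_\alpha\subseteq N \text{ with } |N_\alpha|=\alpha,$$ and, if $UB$ is the objective function value of a feasible solution of the discrete $\alpha$-neighbor $p$-center problem, the inequalities $$\sum_{j\in N\setminus\{i\}:\, d_{ij}\le UB} y_j\ge \alpha(1-y_i)\quad\forall i\in N$$ are optimality-preserving inequalities for the formulation (APC1), i.e., when adding both of these families of inequalities to (APC1), the optimal objective function value does not change.
   Context: Discrete $\alpha$-neighbor $p$-center problem (d-$\alpha$-$p$CP): given are a finite set of points $N$ (indexed, so that points can be compared by index, written $j'<j$), a positive integer $p<|N|$, a positive integer $\alpha\le p$, and distances $d_{ij}\ge 0$ for $i,j\in N$. A feasible solution is a set $P\subseteq N$ with $|P|=p$ (open facilities). For $i\in N\setminus P$ let $d_\alpha(P,i)=\min_{A\subseteq P,|A|=\alpha}\max_{j\in A} d_{ij}$, and let $f_\alpha(P)=\max_{i\in N\setminus P} d_\alpha(P,i)$ be the objective function value of $P$. The problem is $\min_{P\subseteq N,|P|=p} f_\alpha(P)$. For $i,j\in N$ let $S_{ij}=\{j'\in N: (d_{ij'}<d_{ij}) \text{ or } (d_{ij'}=d_{ij}\text{ and } j'<j)\}$. Formulation (APC1), in variables $y_j$ ($j\in N$), $x_{ij}$ ($i,j\in N$, $i\ne j$), $z$: minimize $z$ subject to - $\sum_{j\in N} y_j = p$; - $\sum_{j\in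 N\setminus\{i\}} x_{ij}=\alpha(1-y_i)$ for all $i\in N$; - $x_{ij}\le y_j$ for all $i,j\in N$, $i\ne j$; - $d_{ij}x_{ij}\le z$ for all $i,j\in N$, $i\neq j$; - $x_{ij}\in\{0,1\}$ for all $i,j\in N$, $i\ne j$; $y_j\in\{0,1\}$ for all $j\in N$; $z\in\mathbb{R}$. *)

(* Defs.v *)
From mathcomp Require Import all_boot all_order all_algebra.
Set Implicit Arguments.
Unset Strict Implicit.
Unset Printing Implicit Defensive.
Import Order.TTheory GRing.Theory Num.Theory.
Local Open Scope ring_scope.

(* Minimum and maximum of F over a finite set; the value on the empty set is
   the junk value 0. *)
Definition min_over (R : realFieldType) (I : finType) (A : {set I})
    (F : I -> R) : R :=
  if [pick x in A] is Some x0 then F [arg min_(x < x0 in A) F x]%O else 0.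

Definition max_over (R : realFieldType) (I : finType) (A : {set I})
    (F : I -> R) : R :=
  if [pick x in A] is Some x0 then F [arg max_(x > x0 in A) F x]%O else 0.

(* Instances of the discrete alpha-neighbor p-center problem have point set
   'I_n and distance function d, which need not be symmetric nor vanish on the
   diagonal. *)

(* d_alpha(P, i) *)
Definition alpha_dist (R : realFieldType) (n : nat) (d : 'I_n -> 'I_n -> R)
    (alpha : nat) (P : {set 'I_n}) (i : 'I_n) : R :=
  min_over [set A : {set 'I_n} | (A \subset P) && (#|A| == alpha)]
           (fun A => max_over A (d i)).

(* f_alpha(P) *)
Definition center_obj (R : realFieldType) (n : nat) (d : 'I_n -> 'I_n -> R)
    (alpha : nat) (P : {set 'I_n}) : R :=
  max_over (~: P) (alpha_dist d alpha P).

Definition center_feasible (n p : nat) (P : {set 'I_n}) : Prop := #|P| = p.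

Definition closer (R : realFieldType) (n : nat) (d : 'I_n -> 'I_n -> R)
    (i j : 'I_n) : {set 'I_n} :=
  [set j' : 'I_n | (d i j' < d i j) || ((d i j' == d i j) && (j' < j)%N)].

(* The diagonal entries x i i are not variables of the formulation: no
   constraint below mentions them; in closest_ineqs, i is excluded from the
   x-sum because Na is nonempty when 0 < alpha. *)
Record point (R : realFieldType) (n : nat) := Point {
  yvar : 'I_n -> R;
  xvar : 'I_n -> 'I_n -> R;
  zvar : R
}.

Record APC1 (R : realFieldType) (n p alpha : nat) (d : 'I_n -> 'I_n -> R)
    (s : point R n) : Prop := {
  apc1_open : \sum_(j < n) yvar s j = p%:R;
  apc1_assign : forall i,
    \sum_(j < n | j != i) xvar s i j = alpha%:R * (1 - yvar s i);
  apc1_link : forall i j, i != j -> xvar s i j <= yvar s j;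
  apc1_obj : forall i j, i != j -> d i j * xvar s i j <= zvar s;
  apc1_xbin : forall i j, i != j -> xvar s i j = 0 \/ xvar s i j = 1;
  apc1_ybin : forall j, yvar s j = 0 \/ yvar s j = 1
}.

Definition closest_ineqs (R : realFieldType) (n alpha : nat)
    (d : 'I_n -> 'I_n -> R) (s : point R n) : Prop :=
  forall (i : 'I_n) (Na : {set 'I_n}), #|Na| = alpha ->
    \sum_(j in Na) yvar s j
    + \sum_(j in ~: \bigcup_(j' in Na) (closer d i j' :|: [set i; j']))
        xvar s i j
    <= alpha%:R.

Definition bound_ineqs (R : realFieldType) (n alpha : nat)
    (d : 'I_n -> 'I_n -> R) (UB : R) (s : point R n) : Prop :=
  forall i : 'I_n,
    \sum_(j < n | (j != i) && (d i j <= UB)) yvar s j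
    >= alpha%:R * (1 - yvar s i).

Definition is_opt_value (R : realFieldType) (T : Type) (feas : T -> Prop)
    (obj : T -> R) (v : R) : Prop :=
  (exists2 s, feas s & obj s = v) /\ (forall s, feas s -> v <= obj s).

(* Main.v *)
Require Import Defs.
From mathcomp Require Import all_boot all_order all_algebra.
Set Implicit Arguments.
Unset Strict Implicit.
Unset Printing Implicit Defensive.
Import Order.TTheory GRing.Theory Num.Theory.
Local Open Scope ring_scope.

(** Binary points of (APC1) are pairs of an open set [P] and a choice, for each
    closed [i], of an [alpha]-subset [T i] of [P]; the least admissible [z] is
    then the largest distance of a chosen pair.  Hence [z] is never below
    [center_obj d alpha P] ([APC1_center_obj]), and both optimal values equal
    the least value of [center_obj] over the [p]-subsets.

    To attain that value within the strengthened formulation, take an optimal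
    [P] and let [T i] consist of the [alpha] open points that come first when
    points are ordered by distance to [i], ties being broken by index.  The
    proof relies on [T i] being closed downwards in [P] for this order
    ([closest_set], [closest_set_exists]):
    - an exchange argument shows that its distances are at most
      [alpha_dist d alpha P i], so [z] can be set to the objective value of [P]
      ([closest_set_le_dist], [closest_point_APC1]);
    - in the first family, every [j] in the second sum comes after all of [Na],
      so if such a [j] is assigned to [i] then every open point of [Na] is
      assigned to [i] as well; both sums together count distinct elements of
      [T i], of which there are [alpha] ([closest_point_closest_ineqs]);
    - in the second family, [T i] itself provides [alpha] open points within
      distance [center_obj d alpha P <= UB] ([closest_point_bound_ineqs]). *)

(** * Extrema over finite sets *)

Lemma min_overP (R : realFieldType) (I : finType) (A : {set I}) (F : I -> R)
    (a : I) : a \in A ->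
  exists2 x, x \in A & min_over A F = F x /\ {in A, forall y, F x <= F y}.
Proof.
move=> aA; rewrite /min_over; case: pickP => [x0 x0A|/(_ a)]; last by rewrite aA.
by case: arg_minP => // x xA minx; exists x.
Qed.

Lemma max_overP (R : realFieldType) (I : finType) (A : {set I}) (F : I -> R)
    (a : I) : a \in A ->
  exists2 x, x \in A & max_over A F = F x /\ {in A, forall y, F y <= F x}.
Proof.
move=> aA; rewrite /max_over; case: pickP => [x0 x0A|/(_ a)]; last by rewrite aA.
by case: arg_maxP => // x xA maxx; exists x.
Qed.

Lemma le_max_over (R : realFieldType) (I : finType) (A : {set I}) (F : I -> R)
    (a : I) : a \in A -> F a <= max_over A F.
Proof. by move=> aA; have [x xA [-> ->]] := max_overP F aA. Qed.

Lemma sum_mem_card (R : realFieldType) (I : finType) (Q : pred I)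
    (B : {set I}) :
  \sum_(j | Q j) (j \in B)%:R = #|[set j in B | Q j]|%:R :> R.
Proof.
rewrite -natr_sum; congr (_%:R); rewrite -sum1_card big_mkcond /=.
rewrite [RHS]big_mkcond; apply: eq_bigr => j _.
by rewrite inE; case: (Q j); case: (j \in B).
Qed.

(** * Feasible points of the formulation *)

Lemma alpha_dist_le (R : realFieldType) (n alpha : nat)
    (d : 'I_n -> 'I_n -> R) (P A : {set 'I_n}) (i : 'I_n) (z : R) :
  (0 < alpha)%N -> A \subset P -> #|A| = alpha ->
  {in A, forall j, d i j <= z} -> alpha_dist d alpha P i <= z.
Proof.
move=> alpha_gt0 AP cA dA.
have Ain : A \in [set A : {set 'I_n} | (A \subset P) && (#|A| == alpha)].
  by rewrite inE AP cA eqxx.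
have [a aA] : exists a, a \in A by apply/card_gt0P; rewrite cA.
rewrite /alpha_dist; have [B _ [-> minB]] := min_overP (fun A => max_over A (d i)) Ain.
apply: (le_trans (minB _ Ain)).
by have [x xA [-> _]] := max_overP (d i) aA; apply: dA.
Qed.

(** The witness [P] is the support of [yvar].  For [i] outside [P], the support
    of row [i] of [xvar] is an [alpha]-subset of [P] all of whose distances to
    [i] are at most [zvar s], so it bounds the minimum [alpha_dist]. *)
Lemma APC1_center_obj (R : realFieldType) (n p alpha : nat)
    (d : 'I_n -> 'I_n -> R) (s : point R n) :
  (p < n)%N -> (0 < alpha)%N -> APC1 p alpha d s ->
  exists2 P : {set 'I_n}, #|P| = p & center_obj d alpha P <= zvar s.
Proof.
move=> p_lt_n alpha_gt0 [yp xalpha xy dxz xbin ybin].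
pose P := [set j | yvar s j == 1].
have yE j : yvar s j = (j \in P)%:R.
  by rewrite inE; case: (ybin j) => ->; rewrite ?eqxx // eq_sym oner_eq0.
have cP : #|P| = p.
  apply/eqP; rewrite -(eqr_nat R) -yp (eq_bigr _ (fun j _ => yE j)).
  by rewrite sum_mem_card; apply/eqP; congr (_%:R); apply: eq_card=> j;
     rewrite inE andbT.
exists P => //.
have [i0 i0P] : exists i, i \in ~: P.
  by apply/card_gt0P; rewrite cardsCs setCK cP card_ord subn_gt0.
rewrite /center_obj; have [i iP [-> _]] := max_overP (alpha_dist d alpha P) i0P.
rewrite inE in iP.
pose A := [set j | (j != i) && (xvar s i j == 1)].
apply: (@alpha_dist_le _ _ _ _ _ A) => //.
- apply/subsetP => j; rewrite !inE => /andP[ji /eqP xj].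
  have := xy i j; rewrite eq_sym xj => /(_ ji).
  by case: (ybin j) => ->; rewrite ?eqxx // ler10.
- apply/eqP; rewrite -(eqr_nat R); move: (xalpha i).
  rewrite yE (negPf iP) subr0 mulr1 => <-.
  rewrite (eq_bigr (fun j => (j \in A)%:R)).
    rewrite sum_mem_card; apply/eqP; congr (_%:R); apply: eq_card => j.
    by rewrite !inE; case: (j != i); rewrite ?andbT.
  move=> j ji; rewrite inE ji /=.
  have ij : i != j by rewrite eq_sym.
  by case: (xbin i j ij) => ->; rewrite ?eqxx // eq_sym oner_eq0.
- move=> j; rewrite inE => /andP[ji /eqP xj].
  by have := dxz i j; rewrite xj mulr1 eq_sym; apply.
Qed.

(** * Closest assignments *)

Lemma closer_irr (R : realFieldType) (n : nat) (d : 'I_n -> 'I_n -> R)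
    (i j : 'I_n) : j \notin closer d i j.
Proof. by rewrite inE ltxx ltnn andbF. Qed.

Lemma closer_total (R : realFieldType) (n : nat) (d : 'I_n -> 'I_n -> R)
    (i j j' : 'I_n) :
  j \notin closer d i j' -> j != j' -> j' \in closer d i j.
Proof.
rewrite !inE; case: (ltgtP (d i j) (d i j')) => //= _; rewrite -leqNgt => jj' ne.
by rewrite ltn_neqAle jj' andbT eq_sym.
Qed.

Lemma closer_proper (R : realFieldType) (n : nat) (d : 'I_n -> 'I_n -> R)
    (i j j' : 'I_n) :
  j' \in closer d i j -> closer d i j' \proper closer d i j.
Proof.
move=> j'j; apply/properP; split; last by exists j' => //; apply: closer_irr.
move: j'j; rewrite inE => j'j; apply/subsetP => k; rewrite !inE => kj'.
case/orP: j'j kj' => [j'j|/andP[/eqP -> j'j]] /orP[kj'|/andP[/eqP E kj']].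
- by rewrite (lt_trans kj' j'j).
- by rewrite E j'j.
- by rewrite kj'.
- by rewrite E eqxx (ltn_trans kj' j'j) orbT.
Qed.

Definition closest_set (R : realFieldType) (n : nat) (d : 'I_n -> 'I_n -> R)
    (P : {set 'I_n}) (alpha : nat) (i : 'I_n) (A : {set 'I_n}) : Prop :=
  [/\ A \subset P, #|A| = alpha
    & forall j j', j \in A -> j' \in P -> j' \in closer d i j -> j' \in A].

(** The set grows one point at a time.  The number of points preceding [j]
    strictly increases along the order, so minimising it over the unused points
    of [P] gives one whose predecessors in [P] have all been used. *)
Lemma closest_set_exists (R : realFieldType) (n : nat)
    (d : 'I_n -> 'I_n -> R) (P : {set 'I_n}) (alpha : nat) (i : 'I_n) :
  (alpha <= #|P|)%N -> exists A, closest_set d P alpha i A.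
Proof.
elim: alpha => [_|k IH kP].
  by exists set0; split; rewrite ?sub0set ?cards0 // => j j'; rewrite inE.
have [A [AP cA clA]] := IH (ltnW kP).
have [a aPA] : exists a, a \in P :\: A.
  by apply/card_gt0P; rewrite cardsDS // cA subn_gt0.
have [j] : exists2 j, j \in P :\: A
    & {in P :\: A, forall l, #|closer d i j| <= #|closer d i l|}%N.
  by case: (arg_minnP (fun j => #|closer d i j|) aPA) => j; exists j.
rewrite inE => /andP[jA jP] minj.
exists (j |: A); split.
- by rewrite subUset sub1set jP.
- by rewrite cardsU1 jA cA.
move=> l j' /setU1P[->|lA] j'P j'l; apply/setU1P; right; last exact: clA j'l.
apply: contraT => j'A; have /minj : j' \in P :\: A by rewrite inE j'A j'P.
by rewrite leqNgt proper_card // closer_proper.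
Qed.

(** Exchange: an [alpha]-subset of [P] other than [A] contains a point outside
    [A], which is at least as far from [i] as every point of [A]. *)
Lemma closest_set_le_dist (R : realFieldType) (n alpha : nat)
    (d : 'I_n -> 'I_n -> R) (P A : {set 'I_n}) (i j : 'I_n) :
  closest_set d P alpha i A -> j \in A -> d i j <= alpha_dist d alpha P i.
Proof.
case=> AP cA clA jA.
have Ain : A \in [set A : {set 'I_n} | (A \subset P) && (#|A| == alpha)].
  by rewrite inE AP cA eqxx.
rewrite /alpha_dist; have [B + [-> _]] := min_overP (fun A => max_over A (d i)) Ain.
rewrite inE => /andP[BP /eqP cB].
have [BA|/subsetPn[b bB bA]] := boolP (B \subset A).
  apply: le_max_over; suff -> : B = A by [].
  by apply/eqP; rewrite eqEcard BA cA cB leqnn.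
apply: le_trans (le_max_over (d i) bB); rewrite leNgt.
apply: contra bA => lt_bj; apply: (clA j) => //; first exact: (subsetP BP).
by rewrite inE lt_bj.
Qed.

Lemma alpha_dist_le_center_obj (R : realFieldType) (n alpha : nat)
    (d : 'I_n -> 'I_n -> R) (P : {set 'I_n}) (i : 'I_n) :
  i \notin P -> alpha_dist d alpha P i <= center_obj d alpha P.
Proof. by move=> iP; apply: le_max_over; rewrite inE. Qed.

Definition assignment_point (R : realFieldType) (n : nat) (P : {set 'I_n})
    (T : 'I_n -> {set 'I_n}) (z : R) : point R n :=
  Point (fun j => (j \in P)%:R)
        (fun i j => ((i \notin P) && (j \in T i))%:R) z.

Section ClosestPoint.

Variables (R : realFieldType) (n p alpha : nat) (d : 'I_n -> 'I_n -> R).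
Variables (P : {set 'I_n}) (T : 'I_n -> {set 'I_n}).
Hypothesis T_closest : forall i, closest_set d P alpha i (T i).

Let s := assignment_point P T (center_obj d alpha P).

Lemma closest_point_APC1 :
  (p < n)%N -> (0 < alpha)%N -> (forall i j, 0 <= d i j) -> #|P| = p ->
  APC1 p alpha d s.
Proof.
move=> p_lt_n alpha_gt0 d_ge0 cP; split=> /=.
- rewrite sum_mem_card -cP; congr (_%:R); apply: eq_card => j.
  by rewrite inE andbT.
- move=> i; have [TP cT _] := T_closest i.
  have [iP|iP] /= := boolP (i \in P).
    by rewrite subrr mulr0 big1.
  rewrite subr0 mulr1 sum_mem_card -cT; congr (_%:R).
  apply: eq_card => j; rewrite inE andb_idr //.
  by move/(subsetP TP); apply: contraTneq => ->.
- move=> i j _; have [TP _ _] := T_closest i.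
  rewrite ler_nat; case: andP => // -[_ jT]; first by rewrite (subsetP TP).
- move=> i j _.
  have [i0 i0P] : exists i, i \in ~: P.
    by apply/card_gt0P; rewrite cardsCs setCK cP card_ord subn_gt0.
  rewrite inE in i0P.
  have [/andP[iP jT]|_] := boolP ((i \notin P) && (j \in T i)).
    rewrite mulr1; apply: le_trans (alpha_dist_le_center_obj alpha d iP).
    exact: closest_set_le_dist jT.
  (* The constraint reads 0 <= z here: compare with any actual assignment. *)
  rewrite mulr0; have [_ cT _] := T_closest i0.
  have [a aT] : exists a, a \in T i0 by apply/card_gt0P; rewrite cT.
  apply: le_trans (alpha_dist_le_center_obj alpha d i0P).
  by apply: le_trans (closest_set_le_dist (T_closest i0) aT).
- by move=> i j _; case: andP; [right|left].
- by move=> j; case: (j \in P); [right|left].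
Qed.

(** If the second sum counts no assigned point, the bound is [#|Na| = alpha];
    otherwise one assigned point after [Na] puts all open points of [Na] in
    [T i], by downward closure. *)
Lemma closest_point_closest_ineqs : closest_ineqs alpha d s.
Proof.
move=> i Na cNa /=; have [TP cT clT] := T_closest i.
set U := \bigcup_(_ in _) _.
have small : (#|[set j in P | j \in Na]| <= alpha)%N.
  by rewrite -cNa; apply/subset_leq_card/subsetP => j; rewrite inE => /andP[].
rewrite sum_mem_card; have [iP|iP] /= := boolP (i \in P).
  by rewrite big1 // addr0 ler_nat.
rewrite sum_mem_card -natrD ler_nat.
set X := [set j in T i | _].
have [->|[j]] := set_0Vmem X; first by rewrite cards0 addn0.
(* Assigned points outside [U] come strictly after every point of [Na]. *)
have before k j' : k \in X -> j' \in Na ->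
    [/\ k \in T i, k != j' & j' \in closer d i k].
  rewrite inE => /andP[kT kU] j'Na; have : k \notin U by rewrite -in_setC.
  move/bigcupP => kNU.
  have /norP[k1 /norP[_ k2]] :
      ~~ [|| k \in closer d i j', k == i | k == j'].
    by apply/negP => H; apply: kNU; exists j' => //; rewrite in_setU in_set2.
  by split=> //; apply: closer_total.
move=> jX; rewrite -[leqRHS]cT.
rewrite -(_ : #|[set j in P | j \in Na] :|: X|
             = (#|[set j in P | j \in Na]| + #|X|)%N).
  apply/subset_leq_card/subsetP => k; rewrite inE => /orP[|]; rewrite inE.
    case/andP=> kP kNa; have [jT _ kj] := before _ _ jX kNa.
    exact: clT kj.
  by case/andP.
apply/eqP; rewrite (leq_card_setU _ _).2; apply/pred0P => k /=.
apply/negP => /andP[]; rewrite inE => /andP[_ kNa] kX.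
by have [_ /eqP] := before _ _ kX kNa.
Qed.

Lemma closest_point_bound_ineqs UB :
  center_obj d alpha P <= UB -> bound_ineqs alpha d UB s.
Proof.
move=> leUB i /=; have [TP cT _] := T_closest i.
rewrite sum_mem_card; have [iP|iP] /= := boolP (i \in P).
  by rewrite subrr mulr0 ler0n.
rewrite subr0 mulr1 ler_nat -[leqLHS]cT.
apply/subset_leq_card/subsetP => j jT; have jP := subsetP TP j jT.
rewrite inE jP /=; apply/andP; split.
  by apply: contraTneq jP => ->.
apply: le_trans leUB; apply: le_trans (alpha_dist_le_center_obj alpha d iP).
exact: closest_set_le_dist jT.
Qed.

End ClosestPoint.

Theorem theorem3 (R : realFieldType) (n p alpha : nat)
  (d : 'I_n -> 'I_n -> R)
  (p_gt0 : (0 < p)%N) (p_lt_n : (p < n)%N)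
  (alpha_gt0 : (0 < alpha)%N) (alpha_le_p : (alpha <= p)%N)
  (d_ge0 : forall i j, 0 <= d i j)
  (UB : R)
  (hUB : exists2 P0 : {set 'I_n},
           center_feasible p P0 & center_obj d alpha P0 = UB) :
  exists v : R,
    is_opt_value (APC1 p alpha d) (@zvar R n) v /\
    is_opt_value
      (fun s => [/\ APC1 p alpha d s, closest_ineqs alpha d s
                  & bound_ineqs alpha d UB s])
      (@zvar R n) v.
Proof.
case: hUB => P0 cP0 objP0.
have P0in : P0 \in [set P : {set 'I_n} | #|P| == p] by rewrite inE cP0.
have [P + [_ minP]] := min_overP (center_obj d alpha) P0in.
rewrite inE => /eqP cP; exists (center_obj d alpha P).
have leUB : center_obj d alpha P <= UB by rewrite -objP0 minP.
have lower s : APC1 p alpha d s -> center_obj d alpha P <= zvar s.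
  move=> /(APC1_center_obj p_lt_n alpha_gt0)[Q cQ]; apply: le_trans.
  by apply: minP; rewrite inE cQ.
have /fin_all_exists[T T_closest] :
    forall i, exists A, closest_set d P alpha i A.
  by move=> i; apply: closest_set_exists; rewrite cP.
have feas := closest_point_APC1 T_closest p_lt_n alpha_gt0 d_ge0 cP.
split; split=> //; last by move=> s [/lower].
  by exists (assignment_point P T (center_obj d alpha P)).
exists (assignment_point P T (center_obj d alpha P)) => //; split=> //.
  exact: closest_point_closest_ineqs.
exact: closest_point_bound_ineqs.
Qed.
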